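(* Let $G$ be a (finite, simple, non-null) graph without isolated vertices such that $\Delta(G)-\delta(G)\leq 3$. If either $\delta(G)\neq 2$ or $\Delta(G)\neq 5$ holds, then $$\frac{M_1(G)}{n(G)}\leq\frac{M_2(G)}{m(G)}.$$ Equality holds if and only if $\mathbb{F}(G)$ is one of $\{\{\Delta(G),\delta(G)\}\}$, $\{\{1,4\},\{2,2\}\}$, or $\{\{3,6\},\{4,4\}\}$.
   Context: All graphs are finite, simple, non-null and have no isolated vertices (they need not be connected). For a graph $G$ with vertex set $V(G)$ and edge set $E(G)$: $n(G)=|V(G)|$ is the order, $m(G)=|E(G)|$ is the size, $d_G(u)$ is the degree of a vertex $u$, and $\Delta(G)$ and $\delta(G)$ are the maximum and minimum degrees. The first and second Zagreb indices are $M_1(G)=\sum_{v\in V(G)}d_G(v)^2$ and $M_2(G)=\sum_{uv\in E(G)}d_G(u)d_G(v)$. The set $\mathbb{F}(G)=\{\{d_G(u),d_G(v)\}: uv\in E(G)\}$ is the set of unordered pairs (possibly with repeated entry, e.g. $\{2,2\}$) of degrees of endpoints of edges of $G$. *)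

(* Defs.v *)
From mathcomp Require Export all_boot all_order all_algebra.
From mathcomp Require Export finmap multiset.

Set Implicit Arguments.
Unset Strict Implicit.
Unset Printing Implicit Defensive.

Local Open Scope fset_scope.
Local Open Scope mset_scope.
Local Open Scope nat_scope.

Record sgraph := SGraph {
  vertex :> finType;
  adj : rel vertex;
  adj_sym : symmetric adj;
  adj_irrefl : irreflexive adj
}.

Section Invariants.
Variable G : sgraph.

Definition edges : {set {set G}} :=
  [set [set p.1; p.2] | p : G * G & adj p.1 p.2].

Definition gorder : nat := #|G|.
Definition gsize : nat := #|edges|.

Definition deg (u : G) : nat := #|[set v | adj u v]|.

Definition no_isolated : Prop := forall u : G, 0 < deg u.

Definition max_deg : nat := \max_(u : G) deg u.

(* The default value [gorder] exceeds every degree, so for a non-null graph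
   this is the minimum of the degrees. *)
Definition min_deg : nat := \big[minn/gorder]_(u : G) deg u.

Definition zagreb1 : nat := \sum_(u : G) deg u ^ 2.

(* An edge is a two-element set of vertices, so the inner product is
   [deg u * deg v] for the edge [uv]. *)
Definition zagreb2 : nat := \sum_(e in edges) \prod_(u in e) deg u.

(* Unordered pairs are multisets, so that the degree pair {2,2} keeps its
   repeated entry. *)
Definition edge_degrees : {fset {mset nat}} :=
  [fset [mset deg u; deg v]%mset | u : G, v : G & adj u v]%fset.

End Invariants.

(* Main.v *)
(* Summing over the arcs (p, q) of the graph, that is, over its edges taken with
   both orientations, 2m, 2n, 2 M_1 and 2 M_2 are the sums of 1, 1/d(p) + 1/d(q),
   d(p) + d(q) and d(p) d(q).  Hence 8 (M_2 n - M_1 m) is the sum, over all pairs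
   of arcs with end degrees (a, b) and (c, d), of
     (ab - cd) ((1/c + 1/d) - (1/a + 1/b)).
   Every such term is nonnegative: this is clear when the two pairs are
   comparable componentwise, and otherwise one of them is nested strictly inside
   the other, which leaves few cases as all degrees lie within distance 3; only
   {2,5} against {3,3} is negative.  The term vanishes only for equal
   pairs, for {1,4} against {2,2} (equal products) and for {3,6} against {4,4}
   (equal sums of reciprocals). *)
Require Import Defs.
From mathcomp Require Import zify ring.
Import Order.TTheory GRing.Theory Num.Theory.
Local Open Scope fset_scope.
Local Open Scope mset_scope.
Local Open Scope nat_scope.

(** * Inequalities between pairs of degrees *)

(* The second inequality is 1/a + 1/b < 1/c + 1/d with denominators cleared. *)
Lemma mul_lt_harmonic a b c d :
  0 < c -> 0 < d -> c <= a -> d <= b -> ~ (a = c /\ b = d) ->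
  c * d < a * b /\ c * d * (a + b) < a * b * (c + d).
Proof.
move=> c0 d0 /subnKC <- /subnKC <-; set x := a - c; set y := b - d => ne.
have xy : 0 < x + y by lia.
have [x0|y0] : 0 < x \/ 0 < y by lia.
  by split; nia.
by split; nia.
Qed.

(** The inner pair is strictly ahead in both comparisons unless [b = a + 3] and [c = d = a + 1].
    There, over the integers, [a * b - c * d] equals [a - 1] and [a * b * (c + d) - c * d * (a + b)]
    equals [(a + 1) * (a - 3)]: one of them vanishes at [a = 1] and at [a = 3], and they have
    opposite signs only at [a = 2]. *)
Lemma nested_pairs_cases a b c d :
  0 < a -> a < c -> c <= d -> d < b -> b <= a + 3 -> ~ (a = 2 /\ b = 5) ->
  [\/ c * d < a * b /\ c * d * (a + b) < a * b * (c + d),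
      a * b < c * d /\ a * b * (c + d) < c * d * (a + b),
      [/\ a = 1, b = 4, c = 2 & d = 2] | [/\ a = 3, b = 6, c = 4 & d = 4]].
Proof.
move=> a0 ac cd db ba ex.
have [eb|eb] : b = a.+2 \/ b = a.+3 by lia.
  have [ec ed] : c = a.+1 /\ d = a.+1 by lia.
  by subst; constructor 2; split; nia.
have [[ec ed]|[ed ec]] :
    (c = a.+1 /\ d = a.+1) \/ (d = a.+2 /\ (c = a.+1 \/ c = a.+2)) by lia.
  have [a1|[a3|a4]] : a = 1 \/ a = 3 \/ 4 <= a by lia.
  - by constructor 3; split; lia.
  - by constructor 4; split; lia.
  by subst; constructor 1; split; nia.
by case: ec ed => -> ->; subst; constructor 2; split; nia.
Qed.

(** * Unordered pairs, and the sign of the term comparing two of them *)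

Lemma mset2C (a b : nat) : [mset a; b] = [mset b; a].
Proof. exact: msetDC. Qed.

Lemma mset2_inj (a b c d : nat) : [mset a; b] = [mset c; d] ->
  (a = c /\ b = d) \/ (a = d /\ b = c).
Proof.
(* The multiplicities of [a] and of [b] already determine the matching. *)
move=> /msetP E; move: (E a) (E b); rewrite !mset1DE !msetnE !eqxx.
by case: (a =P c); case: (a =P d); case: (b =P c); case: (b =P d) => //=; lia.
Qed.

Definition gap (a b c d : nat) : rat :=
  (((a * b)%:R - (c * d)%:R) * ((c%:R^-1 + d%:R^-1) - (a%:R^-1 + b%:R^-1)))%R.

Lemma gapC a b c d : gap a b c d = gap c d a b.
Proof. by rewrite /gap; ring. Qed.

Lemma gap_swapl a b c d : gap a b c d = gap b a c d.
Proof. by rewrite /gap mulnC [(a%:R^-1 + _)%R]addrC. Qed.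

Lemma gap_swapr a b c d : gap a b c d = gap a b d c.
Proof. by rewrite gapC gap_swapl gapC. Qed.

(** Over the common denominator [a * b * (c * d)], the second factor of [gap] has numerator
    [a * b * (c + d) - c * d * (a + b)], so both factors are positive. *)
Lemma gap_gt0 a b c d : 0 < a -> 0 < b -> 0 < c -> 0 < d ->
  c * d < a * b -> c * d * (a + b) < a * b * (c + d) -> (0 < gap a b c d)%R.
Proof.
move=> a0 b0 c0 d0 lt1 lt2.
have nz n : 0 < n -> (n%:R : rat) != 0%R by rewrite pnatr_eq0 -lt0n.
have -> : gap a b c d = (((a * b)%:R - (c * d)%:R) *
   ((a * b * (c + d))%:R - (c * d * (a + b))%:R) / (a * b * (c * d))%:R)%R.
  by rewrite /gap !natrM !natrD; field; rewrite !nz.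
by rewrite divr_gt0 ?mulr_gt0 ?subr_gt0 ?ltr_nat ?ltr0n ?muln_gt0 ?a0 ?b0 ?c0 ?d0.
Qed.

(** The pairs whose term vanishes. Equating two-element sets makes each exceptional case symmetric
    in [A] and [B]. *)
Variant zero_pair (A B : {mset nat}) : Prop :=
  | ZeroPairEq of A = B
  | ZeroPair14 of [fset A; B] = [fset [mset 1; 4]; [mset 2; 2]]
  | ZeroPair36 of [fset A; B] = [fset [mset 3; 6]; [mset 4; 4]].

Lemma zero_pairC A B : zero_pair A B -> zero_pair B A.
Proof.
case=> [->|E|E]; first by constructor 1.
  by constructor 2; apply: etrans E; apply: fsetUC.
by constructor 3; apply: etrans E; apply: fsetUC.
Qed.

(** Here [k] stands for the minimum degree. The symmetries of [gap] allow assuming [a <= b],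
    [c <= d] and [a <= c]; then either the pairs are comparable or [c], [d] lie strictly between [a]
    and [b]. *)
Lemma gap_sign a b c d k : 0 < k ->
  k <= a <= k + 3 -> k <= b <= k + 3 -> k <= c <= k + 3 -> k <= d <= k + 3 ->
  k <> 2 \/ [/\ a <> 5, b <> 5, c <> 5 & d <> 5] ->
  (0 < gap a b c d)%R \/ zero_pair [mset a; b] [mset c; d].
Proof.
move=> k0.
wlog ab : a b / a <= b => [hw ha hb hc hd ex|].
  have [/hw|/ltnW ba] := leqP a b; first exact.
  rewrite gap_swapl mset2C; apply: hw => //.
  by case: ex => [|[]]; [left|right].
wlog cd : c d / c <= d => [hw ha hb hc hd ex|].
  have [/hw|/ltnW dc] := leqP c d; first exact.
  rewrite gap_swapr (mset2C c); apply: hw => //.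
  by case: ex => [|[]]; [left|right].
wlog ac : a b c d ab cd / a <= c => [hw ha hb hc hd ex|].
  have [ac|/ltnW ca] := leqP a c; first exact: hw.
  have ex' : k <> 2 \/ [/\ c <> 5, d <> 5, a <> 5 & b <> 5].
    by case: ex => [|[]]; [left|right].
  rewrite gapC; have [|] := hw _ _ _ _ cd ab ca hc hd ha hb ex'; first by left.
  by move/zero_pairC; right.
move=> ha hb hc hd ex.
have [a0 b0 c0 d0] : [/\ 0 < a, 0 < b, 0 < c & 0 < d] by split; lia.
have [bd|db] := leqP b d.
  have [/andP[/eqP -> /eqP ->]|/andP ne] := boolP ((c == a) && (d == b)).
    by right; constructor 1.
  have [|lt1 lt2] := mul_lt_harmonic _ _ _ _ a0 b0 ac bd.
    by case=> ea eb; apply: ne; rewrite ea eb.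
  by left; rewrite gapC; apply: gap_gt0.
(* If [c <= a] then [a = c], and the pairs are comparable after all. *)
have [ac'|ca] := ltnP a c; last first.
  have ne : ~ (a = c /\ b = d) by lia.
  by have [] := mul_lt_harmonic _ _ _ _ c0 d0 ca (ltnW db) ne; left; apply: gap_gt0.
have ba : b <= a + 3 by lia.
(* Both 2 and 5 lie between [k] and [k + 3] only for [k = 2], and then 5 is excluded. *)
have ex' : ~ (a = 2 /\ b = 5) by case: ex => [|[]]; lia.
case: (nested_pairs_cases a b c d a0 ac' cd db ba ex').
- by case=> *; left; apply: gap_gt0.
- by case=> *; left; rewrite gapC; apply: gap_gt0.
- by case=> -> -> -> ->; right; constructor 2.
- by case=> -> -> -> ->; right; constructor 3.
Qed.

(** One factor vanishes: the products are both 4 in the first exceptional case, the reciprocal sums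
    both 1/2 in the second. *)
Lemma gap_eq0 a b c d : zero_pair [mset a; b] [mset c; d] -> gap a b c d = 0%R.
Proof.
have mem2 (A B : {mset nat}) F : [fset A; B] = F -> A \in F /\ B \in F.
  by move=> <-; rewrite fset21 fset22.
case=> [/mset2_inj[] [-> ->]|/mem2|/mem2].
- by rewrite /gap subrr mul0r.
- by rewrite gap_swapl /gap subrr mul0r.
- have prod4 x y : [mset x; y] \in [fset [mset 1; 4]; [mset 2; 2]] -> x * y = 4.
    by rewrite in_fset2 => /orP[] /eqP/mset2_inj[] [-> ->].
  by case=> /prod4 ab /prod4 cd; rewrite /gap ab cd subrr mul0r.
have half x y : [mset x; y] \in [fset [mset 3; 6]; [mset 4; 4]] ->
    (x%:R^-1 + y%:R^-1 = 2^-1 :> rat)%R.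
  by rewrite in_fset2 => /orP[] /eqP/mset2_inj[] [-> ->].
by case=> /half ab /half cd; rewrite /gap ab cd subrr mulr0.
Qed.

(** * Families of pairs whose mutual terms all vanish *)

Lemma fset2_disjoint A : A \in [fset [mset 1; 4]; [mset 2; 2]] ->
  A \in [fset [mset 3; 6]; [mset 4; 4]] -> False.
Proof.
(* Neither 1 nor 2 is an entry of a pair in the second set. *)
have not_both a b c e : A = [mset a; b] -> A = [mset c; e] ->
    a <> c -> a <> e -> False.
  by move=> -> /mset2_inj[] [].
move=> /fset2P[/not_both h|/not_both h] /fset2P[/h|/h]; exact.
Qed.

Lemma zero_pair_fset2 A B C D : zero_pair A B -> C \in [fset A; B] ->
  D \in [fset A; B] -> zero_pair C D.
Proof.
move=> AB /fset2P[] -> /fset2P[] ->.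
- by constructor 1.
- exact: AB.
- exact: zero_pairC.
by constructor 1.
Qed.

(** Since [A] lies in at most one exceptional set, any other member of [F] must be its partner
    there, so [F] has at most two elements. *)
Lemma zero_pair_family (F : {fset {mset nat}}) A : A \in F ->
  (forall B C, B \in F -> C \in F -> zero_pair B C) <->
  [\/ F = [fset A], F = [fset [mset 1; 4]; [mset 2; 2]]
     | F = [fset [mset 3; 6]; [mset 4; 4]]].
Proof.
move=> AF; split=> [zF|].
  have [FA|/fsubsetPn[B BF]] := boolP (F `<=` [fset A])%fset.
    constructor 1; apply/eqP; rewrite eqEfsubset FA /=.
    by apply/fsubsetP=> B; rewrite in_fset1 => /eqP->.
  rewrite in_fset1 => /eqP BA.
  have FAB : F = [fset A; B].
    apply/fsetP=> C; apply/idP/idP=> [CF|]; last by case/fset2P=> ->.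
    case: (zF A C AF CF) => [->|eC|eC]; first exact: fset21.
      case: (zF A B AF BF) => [/esym/BA[]|eB|eB].
        by rewrite eB -eC fset22.
      by case: (fset2_disjoint A); [rewrite -eC|rewrite -eB]; apply: fset21.
    case: (zF A B AF BF) => [/esym/BA[]|eB|eB].
      by case: (fset2_disjoint A); [rewrite -eB|rewrite -eC]; apply: fset21.
    by rewrite eB -eC fset22.
  rewrite FAB; case: (zF A B AF BF) => [/esym/BA[]|eB|eB]; first by constructor 2.
  by constructor 3.
case=> -> B C.
- by move=> /fset1P-> /fset1P->; constructor 1.
- by apply: zero_pair_fset2; constructor 2.
by apply: zero_pair_fset2; constructor 3.
Qed.

(** * Extreme degrees and the degree pairs of edges *)

Section Degrees.
Variable G : sgraph.

Lemma deg_le_max (u : G) : deg u <= max_deg G.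
Proof. exact: leq_bigmax. Qed.

Lemma min_deg_le (u : G) : min_deg G <= deg u.
Proof.
rewrite /min_deg; have := mem_index_enum u.
elim: (index_enum _) => // v r IH; rewrite in_cons big_cons geq_min.
by case/orP=> [/eqP->|/IH->]; rewrite ?leqnn ?orbT.
Qed.

Lemma max_deg_attained : 0 < gorder G -> exists u : G, deg u = max_deg G.
Proof. by case/(bigop.eq_bigmax (@deg G)) => u eu; exists u. Qed.

Lemma min_deg_attained : 0 < gorder G -> exists u : G, deg u = min_deg G.
Proof.
move=> /card_gt0P[u0 _].
have [E|//] : min_deg G = gorder G \/ exists u : G, deg u = min_deg G.
  rewrite /min_deg; elim/big_rec: _ => [|u x _ [->|[v <-]]]; first by left.
    by right; exists u; apply/esym/minn_idPl/max_card.
  by right; rewrite /minn; case: ltnP; [exists u|exists v].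
(* Even if the minimum is the default [gorder G], it is attained: [u0] has degree at least this
   minimum and at most [gorder G]. *)
exists u0; apply/eqP; rewrite eqn_leq min_deg_le andbT E.
exact: max_card.
Qed.

Lemma edge_degreesP A :
  reflect (exists2 p : G * G, adj p.1 p.2 & A = [mset deg p.1; deg p.2])
          (A \in edge_degrees G).
Proof.
rewrite /edge_degrees; apply: (iffP (@imfset2P _ _ _ _ _ _ _ _)).
  by case=> u _ [v]; rewrite inE /= => uv ->; exists (u, v).
by case=> -[u v] /= uv ->; exists u => //; exists v; rewrite ?inE.
Qed.

(** Every vertex has a neighbour, so the single pair [A] contains every degree, in particular both
    extremes. *)
Lemma edge_degrees_singleton A : 0 < gorder G -> no_isolated G ->
  edge_degrees G = [fset A] -> A = [mset max_deg G; min_deg G].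
Proof.
move=> nonnull noiso FA.
have nbr (u : G) : exists v : G, A = [mset deg u; deg v].
  have /card_gt0P[v] := noiso u; rewrite inE => uv; exists v.
  by apply/esym/eqP; rewrite -in_fset1 -FA; apply/edge_degreesP; exists (u, v).
have [u eu] := max_deg_attained nonnull; have [w ew] := min_deg_attained nonnull.
have [[v ->] [x]] := (nbr u, nbr w).
have lo := min_deg_le v; have hi := deg_le_max v; rewrite eu ew.
(* When the extremes coincide, [deg v] is squeezed between them. *)
case/mset2_inj => [[em _]|[_ ->] //]; congr [mset _; _]; lia.
Qed.

End Degrees.

(** * Graph invariants as sums over arcs *)

Section Arcs.
Variable G : sgraph.
Implicit Types (p q : G * G).
Local Notation arc := [set p : G * G | adj p.1 p.2].
Local Notation d := (@deg G).

(** Each edge comes from exactly two arcs, distinct because there are no loops. *)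
Lemma sum_arcs_edges {R : nmodType} (F : {set G} -> R) :
  (\sum_(p in arc) F [set p.1; p.2])%R = ((\sum_(e in edges G) F e) *+ 2)%R.
Proof.
rewrite (partition_big_imset (fun p => [set p.1; p.2])) -sumrMnl /=.
apply: eq_bigr => e /imsetP[[x y]]; rewrite inE /= => xy ->{e}.
have neq : x != y by apply: contraTneq xy => ->; rewrite adj_irrefl.
rewrite (eq_bigr (fun=> F [set x; y])) => [|p /andP[_ /eqP->] //].
rewrite (eq_bigl [in [set (x, y); (y, x)]]).
  by rewrite sumr_const cards2 xpair_eqE negb_and neq.
move=> [u v]; rewrite !inE /= !xpair_eqE.
apply/andP/orP => [[uv /eqP E]|[/andP[/eqP-> /eqP->]|/andP[/eqP-> /eqP->]]].
- have uv' : u != v by apply: contraTneq uv => ->; rewrite adj_irrefl.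
  have /set2P uxy : u \in [set x; y] by rewrite -E set21.
  have /set2P vxy : v \in [set x; y] by rewrite -E set22.
  by case: uxy uv' => ->; case: vxy => ->; rewrite ?eqxx //; auto.
- by rewrite eqxx.
by rewrite adj_sym setUC eqxx.
Qed.

Local Open Scope ring_scope.

(** A vertex is the first end of as many arcs as its degree. *)
Lemma sum_arcs_fst (f : nat -> rat) :
  \sum_(p in arc) f (d p.1) = \sum_u f (d u) *+ d u.
Proof.
rewrite (eq_bigl (fun p : G * G => adj p.1 p.2)) => [|p]; last by rewrite inE.
rewrite -(pair_big_dep xpredT (fun u v : G => adj u v) (fun u _ => f (d u))) /=.
apply: eq_bigr => u _; rewrite sumr_const; congr (_ *+ _).
by apply: eq_card => v; rewrite inE.
Qed.

Lemma sum_arcs_snd (f : nat -> rat) :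
  \sum_(p in arc) f (d p.2) = \sum_(p in arc) f (d p.1).
Proof.
rewrite (reindex_inj (h := fun p => (p.2, p.1))) /=; last by case=> ? ? [? ?] [-> ->].
by apply: eq_bigl => p; rewrite !inE adj_sym.
Qed.

Lemma card_arcs : \sum_(p in arc) 1 = (gsize G)%:R *+ 2 :> rat.
Proof. by rewrite (sum_arcs_edges (fun=> 1)) sumr_const. Qed.

Lemma sum_arcs_mul : \sum_(p in arc) (d p.1 * d p.2)%:R = (zagreb2 G)%:R *+ 2 :> rat.
Proof.
rewrite /zagreb2 natr_sum -sum_arcs_edges.
apply: eq_bigr => -[x y]; rewrite inE /= => xy.
rewrite big_setU1 ?big_set1 // inE; apply: contraTneq xy => ->.
by rewrite adj_irrefl.
Qed.

Lemma sum_arcs_add :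
  \sum_(p in arc) ((d p.1)%:R + (d p.2)%:R) = (zagreb1 G)%:R *+ 2 :> rat.
Proof.
rewrite big_split /= (sum_arcs_snd (fun n => n%:R)) (sum_arcs_fst (fun n => n%:R)).
rewrite -mulr2n; congr (_ *+ _).
by rewrite natr_sum; apply: eq_bigr => u _; rewrite natrX expr2 mulr_natr.
Qed.

Lemma sum_arcs_inv : no_isolated G ->
  \sum_(p in arc) ((d p.1)%:R^-1 + (d p.2)%:R^-1) = (gorder G)%:R *+ 2 :> rat.
Proof.
move=> noiso.
rewrite big_split /= (sum_arcs_snd (fun n => n%:R^-1)).
rewrite (sum_arcs_fst (fun n => n%:R^-1)).
rewrite -mulr2n; congr (_ *+ _).
rewrite (eq_bigr (fun=> 1)) ?sumr_const // => u _.
by rewrite -[_ *+ _]mulr_natr mulVf // pnatr_eq0 -lt0n.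
Qed.

Definition arc_gap p q := gap (d p.1) (d p.2) (d q.1) (d q.2).

Lemma sum_gap : no_isolated G ->
  \sum_(p in arc) \sum_(q in arc) arc_gap p q =
  ((zagreb2 G)%:R * (gorder G)%:R - (zagreb1 G)%:R * (gsize G)%:R) *+ 8.
Proof.
move=> noiso.
pose P p : rat := (d p.1 * d p.2)%:R; pose S p : rat := (d p.1)%:R + (d p.2)%:R.
pose I p : rat := (d p.1)%:R^-1 + (d p.2)%:R^-1.
(* This uses [P p * I p = S p]. The factors 1 make every summand a function of [p] times a function
   of [q], so the double sums factor. *)
have gapE p q : arc_gap p q = P p * I q + I p * P q - (S p * 1 + 1 * S q).
  have nz u : (d u)%:R != 0 :> rat by rewrite pnatr_eq0 -lt0n.
  by rewrite /arc_gap /gap /P /I /S !natrM; field; rewrite !nz.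
have sumP : \sum_(p in arc) P p = _ := sum_arcs_mul.
have sumS : \sum_(p in arc) S p = _ := sum_arcs_add.
have sumI : \sum_(p in arc) I p = _ := sum_arcs_inv noiso.
under eq_bigr => p _ do under eq_bigr => q _ do rewrite gapE.
clearbody P S I.
under eq_bigr => p _ do rewrite sumrB !big_split -!mulr_sumr /=.
rewrite sumrB !big_split -!mulr_suml /=.
by rewrite card_arcs sumP sumS sumI; ring.
Qed.

Lemma arc_gap_sign p q : no_isolated G -> (max_deg G - min_deg G <= 3)%N ->
  min_deg G <> 2%N \/ max_deg G <> 5%N ->
  0 < arc_gap p q \/
  zero_pair [mset d p.1; d p.2]%mset [mset d q.1; d q.2]%mset.
Proof.
move=> noiso gap3 ex.
have [u eu] : exists u : G, d u = min_deg G.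
  by apply: min_deg_attained; apply/card_gt0P; exists p.1.
have bnd v : (min_deg G <= d v <= min_deg G + 3)%N.
  by have := min_deg_le _ v; have := deg_le_max _ v; lia.
apply: (gap_sign _ _ _ _ (min_deg G)) => //; first by rewrite -eu.
have [k2|k2] := eqVneq (min_deg G) 2%N; last by left; apply/eqP.
(* With minimum 2 the maximum is at most 5, hence at most 4 by [ex]. *)
have ne5 v : d v <> 5%N by have := deg_le_max _ v; case: ex; lia.
by right; split.
Qed.

End Arcs.

Theorem theorem2p1 (G : sgraph)
  (G_nonnull : 0 < gorder G)
  (G_noiso : no_isolated G)
  (deg_gap : max_deg G - min_deg G <= 3)
  (not_2_5 : min_deg G <> 2 \/ max_deg G <> 5) :
  let r1 : rat := ((zagreb1 G)%:R / (gorder G)%:R)%R in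
  let r2 : rat := ((zagreb2 G)%:R / (gsize G)%:R)%R in
  (r1 <= r2)%R /\
  (r1 = r2 <->
     [\/ edge_degrees G = [fset [mset max_deg G; min_deg G]],
         edge_degrees G = [fset [mset 1; 4]; [mset 2; 2]]
       | edge_degrees G = [fset [mset 3; 6]; [mset 4; 4]]]).
Proof.
move=> r1 r2.
have [u _] := card_gt0P G_nonnull.
have /card_gt0P[v] := G_noiso u; rewrite inE => uv.
have m_gt0 : 0 < gsize G.
  by apply/card_gt0P; exists [set u; v]; apply/imsetP; exists (u, v); rewrite ?inE.
have sign p q := arc_gap_sign G p q G_noiso deg_gap not_2_5.
have gap_ge0 p q : (0 <= arc_gap G p q)%R.
  by case: (sign p q) => [/ltW//|/gap_eq0 E]; rewrite /arc_gap E.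
have sumE := sum_gap G G_noiso.
(* The 8 in the denominator cancels the multiplicity in [sum_gap]. *)
have rE : (r2 - r1 = (\sum_(p in [set p : G * G | adj p.1 p.2])
    \sum_(q in [set p : G * G | adj p.1 p.2]) arc_gap G p q)
      / (8 * (gorder G)%:R * (gsize G)%:R))%R.
  by rewrite sumE /r1 /r2; field; rewrite !pnatr_eq0 -!lt0n m_gt0 G_nonnull.
have den_gt0 : (0 < 8 * (gorder G)%:R * (gsize G)%:R :> rat)%R.
  by rewrite !mulr_gt0 ?ltr0n.
split.
  rewrite -subr_ge0 rE divr_ge0 ?(ltW den_gt0) //.
  by apply: sumr_ge0 => p _; apply: sumr_ge0.
set A := [mset deg u; deg v].
have AF : A \in edge_degrees G by apply/edge_degreesP; exists (u, v).
have zeroE : r1 = r2 <->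
    (forall B C, B \in edge_degrees G -> C \in edge_degrees G -> zero_pair B C).
  split=> [e12 _ _ /edge_degreesP[p pE ->] /edge_degreesP[q qE ->]|zF].
    (* If [r1 = r2], the sum of nonnegative terms is zero, so each term is zero and the positive
       alternative is impossible. *)
    case: (sign p q) => //; suff -> : arc_gap G p q = 0%R by rewrite ltxx.
    move/eqP: rE; rewrite e12 subrr eq_sym mulf_eq0 invr_eq0 (gt_eqF den_gt0) orbF.
    rewrite psumr_eq0 => [|p' _]; last exact: sumr_ge0.
    move/allP/(_ p (mem_index_enum _)); rewrite inE pE /=.
    rewrite psumr_eq0 => [|q' _ //].
    by move/allP/(_ q (mem_index_enum _)); rewrite inE qE => /eqP.
  apply/esym/eqP; rewrite -subr_eq0 rE big1 ?mul0r // => p; rewrite inE => pE.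
  apply: big1 => q; rewrite inE => qE; apply/gap_eq0/zF.
    by apply/edge_degreesP; exists p.
  by apply/edge_degreesP; exists q.
rewrite zeroE (zero_pair_family _ _ AF); split=> -[E|E|E]; first last.
- by constructor 3.
- by constructor 2.
- by constructor 1; move: AF; rewrite E in_fset1 => /eqP->.
- by constructor 3.
- by constructor 2.
by constructor 1; rewrite -(edge_degrees_singleton _ _ G_nonnull G_noiso E).
Qed.
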